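(* Let $(A,\star,\succ,\prec)$ be a pre-APLP algebra and $(A,\cdot,\circ)$ its sub-adjacent anti-pre-Lie Poisson algebra. Let $\{e_1,\dots,e_n\}$ be a basis of $A$ and $\{e_1^*,\dots,e_n^*\}$ the dual basis. Then $$r=\sum_{i=1}^n(e_i\otimes e_i^*-e_i^*\otimes e_i)$$ is a skew-symmetric solution of the APLP-YBE in the semi-direct product anti-pre-Lie Poisson algebra $A\ltimes_{-\mathcal L_\star^*,\,\mathcal R_\prec^*-\mathcal L_\succ^*,\,\mathcal R_\prec^*}A^*$.
   Context: All vector spaces and algebras are finite-dimensional over an algebraically closed field $\mathbb K$ of characteristic zero. Anti-pre-Lie algebra $(A,\circ)$: with $[x,y]=x\circ y-y\circ x$, $x\circ(y\circ z)-y\circ(x\circ z)=[y,x]\circ z$ and $[x,y]\circ z+[y,z]\circ x+[z,x]\circ y=0$. Anti-pre-Lie Poisson algebra $(A,\cdot,\circ)$: $(A,\cdot)$ commutative associative, $(A,\circ)$ anti-pre-Lie, $2(x\circ y)\cdot z-2(y\circ x)\cdot z=y\cdot(x\circ z)-x\cdot(y\circ z)$ and $2x\circ(y\cdot z)=(z\cdot x)\circ y+z\cdot(x\circ y)$. Pre-APLP (pre-(anti-pre-Lie Poisson)) algebra $(A,\star,\succ,\prec)$: write $x\circ y=x\succ y+x\prec y$ and $x\cdot y=x\star y+y\star x$. The bilinear operations satisfy for all $x,y,z$: Zinbiel: $x\star(y\star z)=(y\star x)\star z+(x\star y)\star z$; pre-APL: $(y\circ x)\succ z-(x\circ y)\succ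 z=x\succ(y\succ z)-y\succ(x\succ z)$; $z\prec(x\circ y)=x\succ(z\prec y)+(x\succ z)\prec y-(z\prec x)\prec y$; $(y\circ x)\succ z-(x\circ y)\succ z=(y\succ z)\prec x-(x\succ z)\prec y-(z\prec y)\prec x+(z\prec x)\prec y$; compatibility: $2y\star(x\succ z)-2y\star(z\prec x)=(x\circ y)\star z-x\star(z\prec y)$; $2(x\circ y)\star z-2(y\circ x)\star z=y\star(x\succ z)-x\star(y\succ z)$; $2z\prec(x\cdot y)=(x\star z)\prec y+x\star(z\prec y)$; $2x\succ(y\star z)=(x\cdot y)\succ z+y\star(x\succ z)$; $2x\succ(y\star z)=(x\star z)\prec y+(x\circ y)\star z$. Then $(A,\cdot,\circ)$ is an anti-pre-Lie Poisson algebra, called sub-adjacent. Put $\mathcal L_\star(x)y=x\star y$, $\mathcal L_\succ(x)y=x\succ y$, $\mathcal R_\prec(x)y=y\prec x$; $(\mathcal L_\star,\mathcal L_\succ,\mathcal R_\prec,A)$ is a representation of $(A,\cdot,\circ)$ (in the sense that the semi-direct product below is an anti-pre-Lie Poisson algebra). For $\mu,l,r:A\to\mathrm{End}(V)$ defining a representation of $(A,\cdot,\circ)$, the semi-direct product $A\ltimes_{\mu,l,r}V$ is the anti-pre-Lie Poisson algebra $A\oplus V$ with $(x+u)\cdot(y+v)=x\cdot y+\mu(x)v+\mu(y)u$ and $(x+u)\circ(y+v)=x\circ y+l(x)v+r(y)u$. For linear $\rho:A\to\mathrm{End}(V)$, $\langle\rho^*(x)u^*,v\rangle=-\langle u^*,\rho(x)v\rangle$.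 If $(\mu,l,r,V)$ is a representation, so is $(-\mu^*,r^*-l^*,r^*,V^* )$. APLP-YBE: $r=\sum_ia_i\otimes b_i$ is a solution if both $\sum_{i,j}\big(a_i\cdot a_j\otimes b_i\otimes b_j-a_j\otimes a_i\cdot b_j\otimes b_i+a_i\otimes a_j\otimes b_i\cdot b_j\big)=0$ and $\sum_{i,j}\big(a_i\circ a_j\otimes b_i\otimes b_j+a_i\otimes b_i\circ a_j\otimes b_j-a_i\otimes a_j\otimes[b_i,b_j]\big)=0$. $r$ is skew-symmetric if $\tau(r)=-r$, where $\tau(x\otimes y)=y\otimes x$. *)

(* Defs.v *)
From HB Require Import structures.
From mathcomp Require Import all_boot all_order all_algebra.

Set Implicit Arguments.
Unset Strict Implicit.
Unset Printing Implicit Defensive.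

Import GRing.Theory.
Local Open Scope ring_scope.

Section Bilinear.

Variable F : fieldType.
Implicit Types A U V W : vectType F.

(* Bilinear maps are stored in curried form, so that [f x] is the operator of
   left multiplication by [x]; [bilin A V V] is the type of linear maps
   A -> End(V). *)
Definition bilin U V W := 'Hom(U, 'Hom(V, W)).

(* [linfun] is only meaningful on functions that are linear: every use of
   [mk_bilin] below comes with an evaluation lemma. *)
Definition mk_bilin U V W (f : U -> V -> W) : bilin U V W :=
  linfun (fun x => linfun (f x) : 'Hom(V, W)).

Lemma linfunE U V (f : U -> V) : linear f -> linfun f =1 f.
Proof.
move=> linf u.
pose g : {linear U -> V} :=
  HB.pack f (GRing.isLinear.Build F U V *:%R f linf).
exact: (lfunE g).
Qed.

Lemma mk_bilinE U V W (f : U -> V -> W) (x : U) (y : V) :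
  (forall u, linear (f u)) -> (forall v, linear (f^~ v)) ->
  mk_bilin f x y = f x y.
Proof.
move=> linr linl; rewrite /mk_bilin linfunE; first exact: linfunE.
by move=> a u v; apply/lfunP=> w; rewrite !lfun_simp !linfunE ?linl.
Qed.

Definition flip U V W (f : bilin U V W) : bilin V U W :=
  mk_bilin (fun y x => f x y).

Lemma flipE U V W (f : bilin U V W) x y : flip f y x = f x y.
Proof.
rewrite mk_bilinE // => [u | v] a b c /=; last by rewrite linearP.
by rewrite linearP !lfun_simp.
Qed.

Definition dual V : vectType F := 'Hom(V, F^o).

Definition dual_rep A V (rho : bilin A V V) : bilin A (dual V) (dual V) :=
  mk_bilin (fun (x : A) (u : dual V) => - (u \o rho x)%VF : dual V).

Lemma dual_repE A V (rho : bilin A V V) x (u : dual V) v :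
  (dual_rep rho x u : dual V) v = - u (rho x v).
Proof.
rewrite mk_bilinE; first by rewrite !lfun_simp.
- by move=> y a b c; apply/lfunP=> w; rewrite !lfun_simp scalerN opprD.
- move=> b a y z; apply/lfunP=> w.
  by rewrite !lfun_simp linearP !lfun_simp linearP scalerN opprD.
Qed.

Definition dual_basis V n (e : n.-tuple V) (i : 'I_n) : dual V :=
  linfun (fun v => coord e i v : F^o).

Lemma dual_basisE V n (e : n.-tuple V) (i : 'I_n) v :
  dual_basis e i v = coord e i v.
Proof. by rewrite linfunE // => a u w; rewrite linearP. Qed.

Lemma dual_basisP V n (e : n.-tuple V) (i j : 'I_n) :
  basis_of fullv e -> dual_basis e i (tnth e j) = (i == j)%:R.
Proof.
move=> be; rewrite dual_basisE (tnth_nth 0).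
by rewrite coord_free ?(basis_free be) // eq_sym.
Qed.

End Bilinear.

Section Tensor.

Variable F : fieldType.
Implicit Types U V W : vectType F.

(* V (x) W is realised as Hom(V^*, W); since V is finite-dimensional, this
   has the universal property of the tensor product: [tens_liftE] and
   [tens_ext] below. *)
Definition tens V W : vectType F := 'Hom(dual V, W).

Definition pure V W : bilin V W (tens V W) :=
  mk_bilin (fun v w => linfun (fun f : dual V => f v *: w) : tens V W).

Lemma pureE V W (v : V) (w : W) (f : dual V) :
  (pure V W v w : tens V W) f = f v *: w.
Proof.
have lin v' w' : linear (fun f : dual V => (f v' : F) *: w' : W).
  by move=> a g h; rewrite !lfun_simp scalerDl scalerA.
rewrite mk_bilinE; first exact: linfunE.
- move=> u a b c; apply/lfunP=> g; rewrite !lfun_simp !linfunE //.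
  by rewrite scalerDr !scalerA mulrC.
- move=> u a b c; apply/lfunP=> g; rewrite !lfun_simp !linfunE //.
  by rewrite linearP scalerDl scalerA.
Qed.

Lemma tens_expand V W n (e : n.-tuple V) (t : tens V W) :
  basis_of fullv e ->
  t = \sum_(i < n) pure V W (tnth e i) (t (dual_basis e i)).
Proof.
move=> be; apply/lfunP=> f; rewrite sum_lfunE.
have fE : f = \sum_(i < n) (f (tnth e i) : F) *: dual_basis e i.
  apply/lfunP=> v; rewrite sum_lfunE [in LHS](coord_basis be (memvf v)).
  rewrite linear_sum; apply: eq_bigr => i _.
  by rewrite linearZ lfun_simp dual_basisE (tnth_nth 0) [RHS]mulrC.
rewrite [in LHS]fE linear_sum; apply: eq_bigr => i _.
by rewrite pureE linearZ.
Qed.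

Lemma tens_decomp V W (t : tens V W) :
  exists n (v : 'I_n -> V) (w : 'I_n -> W),
    t = \sum_(i < n) pure V W (v i) (w i).
Proof.
exists (\dim {:V}), (tnth (vbasis {:V})),
  (fun i => t (dual_basis (vbasis {:V}) i)).
exact: (tens_expand t (vbasisP fullv)).
Qed.

Lemma tens_ext V W U (g h : 'Hom(tens V W, U)) :
  (forall v w, g (pure V W v w) = h (pure V W v w)) -> g = h.
Proof.
move=> gh; apply/lfunP=> t; have [n [v [w ->]]] := tens_decomp t.
by rewrite !linear_sum; apply: eq_bigr => i _; exact: gh.
Qed.

Definition tens_lift V W U (f : bilin V W U) : 'Hom(tens V W, U) :=
  linfun (fun t : tens V W => \sum_(i < \dim {:V})
    f (tnth (vbasis {:V}) i) (t (dual_basis (vbasis {:V}) i))).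

Lemma tens_liftE V W U (f : bilin V W U) v w :
  tens_lift f (pure V W v w) = f v w.
Proof.
rewrite linfunE; last first.
  move=> a s t; rewrite scaler_sumr -big_split; apply: eq_bigr => i _ /=.
  by rewrite !lfun_simp linearP.
rewrite [in RHS](coord_basis (vbasisP {:V}) (memvf v)) linear_sum sum_lfunE.
apply: eq_bigr => i _.
by rewrite pureE dual_basisE !linearZ lfun_simp (tnth_nth 0).
Qed.

(* tau (x (x) y) = y (x) x *)
Definition tens_swap V W : 'Hom(tens V W, tens W V) :=
  tens_lift (flip (pure W V)).

Lemma tens_swapE V W v w : tens_swap V W (pure V W v w) = pure W V w v.
Proof. by rewrite tens_liftE flipE. Qed.

Definition pure3 V (x y z : V) : tens V (tens V V) :=
  pure V (tens V V) x (pure V V y z).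

End Tensor.

Section APLP.

Variable F : fieldType.
Implicit Types A V B : vectType F.

Definition comm A (circ : bilin A A A) (x y : A) : A := circ x y - circ y x.

Record anti_pre_lie A (circ : bilin A A A) : Prop := AntiPreLie {
  apl_assoc : forall x y z,
    circ x (circ y z) - circ y (circ x z) = circ (comm circ y x) z;
  apl_cyclic : forall x y z,
    circ (comm circ x y) z + circ (comm circ y z) x + circ (comm circ z x) y
      = 0
}.

Record aplp A (dot circ : bilin A A A) : Prop := Aplp {
  aplp_dotC : forall x y, dot x y = dot y x;
  aplp_dotA : forall x y z, dot x (dot y z) = dot (dot x y) z;
  aplp_apl : anti_pre_lie circ;
  aplp_compat1 : forall x y z,
    2%:R *: dot (circ x y) z - 2%:R *: dot (circ y x) z
      = dot y (circ x z) - dot x (circ y z);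
  aplp_compat2 : forall x y z,
    2%:R *: circ x (dot y z) = circ (dot z x) y + dot z (circ x y)
}.

Definition sub_dot A (star : bilin A A A) : bilin A A A := star + flip star.

Definition sub_circ A (succ prec : bilin A A A) : bilin A A A := succ + prec.

Lemma sub_dotE A (star : bilin A A A) x y :
  sub_dot star x y = star x y + star y x.
Proof. by rewrite !lfun_simp flipE. Qed.

Lemma sub_circE A (succ prec : bilin A A A) x y :
  sub_circ succ prec x y = succ x y + prec x y.
Proof. by rewrite !lfun_simp. Qed.

Record pre_aplp A (star succ prec : bilin A A A) : Prop := PreAplp {
  pre_zinbiel : forall x y z,
    star x (star y z) = star (star y x) z + star (star x y) z;
  pre_apl1 : forall x y z,
    succ (sub_circ succ prec y x) z - succ (sub_circ succ prec x y) z
      = succ x (succ y z) - succ y (succ x z);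
  pre_apl2 : forall x y z,
    prec z (sub_circ succ prec x y)
      = succ x (prec z y) + prec (succ x z) y - prec (prec z x) y;
  pre_apl3 : forall x y z,
    succ (sub_circ succ prec y x) z - succ (sub_circ succ prec x y) z
      = prec (succ y z) x - prec (succ x z) y
        - prec (prec z y) x + prec (prec z x) y;
  pre_compat1 : forall x y z,
    2%:R *: star y (succ x z) - 2%:R *: star y (prec z x)
      = star (sub_circ succ prec x y) z - star x (prec z y);
  pre_compat2 : forall x y z,
    2%:R *: star (sub_circ succ prec x y) z
      - 2%:R *: star (sub_circ succ prec y x) z
      = star y (succ x z) - star x (succ y z);
  pre_compat3 : forall x y z,
    2%:R *: prec z (sub_dot star x y)
      = prec (star x z) y + star x (prec z y);
  pre_compat4 : forall x y z,
    2%:R *: succ x (star y z)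
      = succ (sub_dot star x y) z + star y (succ x z);
  pre_compat5 : forall x y z,
    2%:R *: succ x (star y z)
      = prec (star x z) y + star (sub_circ succ prec x y) z
}.

Definition semi_dot A V (dot : bilin A A A) (mu : bilin A V V) :
    bilin (A * V)%type (A * V)%type (A * V)%type :=
  mk_bilin (fun p q : A * V => (dot p.1 q.1, mu p.1 q.2 + mu q.1 p.2)).

Definition semi_circ A V (circ : bilin A A A) (l r : bilin A V V) :
    bilin (A * V)%type (A * V)%type (A * V)%type :=
  mk_bilin (fun p q : A * V => (circ p.1 q.1, l p.1 q.2 + r q.1 p.2)).

Lemma semi_circE A V (circ : bilin A A A) (l r : bilin A V V) (p q : A * V) :
  semi_circ circ l r p q = (circ p.1 q.1, l p.1 q.2 + r q.1 p.2).
Proof.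
have lin2 U V' W (f : bilin U V' W) a u u' v :
    f (a *: u + u') v = a *: f u v + f u' v by rewrite linearP !lfun_simp.
rewrite mk_bilinE // => [[x u] | [y v]] a [y1 v1] [y2 v2]; congr pair => /=.
- by rewrite linearP.
- by rewrite lin2 linearP scalerDr addrACA.
- by rewrite lin2.
- by rewrite lin2 linearP scalerDr addrACA.
Qed.

Lemma semi_dotE A V (dot : bilin A A A) (mu : bilin A V V) (p q : A * V) :
  semi_dot dot mu p q = (dot p.1 q.1, mu p.1 q.2 + mu q.1 p.2).
Proof. exact: semi_circE. Qed.

(* The two equations do not depend on the decomposition of [t], and every [t]
   has one by [tens_decomp]. *)
Definition aplp_ybe B (dot circ : bilin B B B) (t : tens B B) : Prop :=
  forall n (a b : 'I_n -> B), t = \sum_(i < n) pure B B (a i) (b i) ->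
     \sum_(i < n) \sum_(j < n)
        (pure3 (dot (a i) (a j)) (b i) (b j)
         - pure3 (a j) (dot (a i) (b j)) (b i)
         + pure3 (a i) (a j) (dot (b i) (b j))) = 0
  /\ \sum_(i < n) \sum_(j < n)
        (pure3 (circ (a i) (a j)) (b i) (b j)
         + pure3 (a i) (circ (b i) (a j)) (b j)
         - pure3 (a i) (a j) (comm circ (b i) (b j))) = 0.

Definition tens_skew B (t : tens B B) : Prop := tens_swap B B t = - t.

End APLP.

(* Main.v *)
(* Contracting a tensor [t] on its left leg gives a map from [dual B] to [B];
   for skew [t] the two equations of the APLP-YBE become the cyclic identities
     f (t g . t h) + g (t h . t f) + h (t f . t g) = 0  and
     f (t g o t h) - g (t f o t h) - h ([t f, t g]) = 0,
   for all functionals [f], [g], [h].  On [B = A + A^*] a functional is a pair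
   (u, a) in A^* x A, and the canonical [r] sends it to [(- a, u)]; the
   identities then reduce to the splittings [x . y = x * y + y * x] and
   [x o y = x > y + x < y].  That the semi-direct product is an anti-pre-Lie
   Poisson algebra amounts to trilinear identities in [A], each of which is an
   explicit linear combination of the pre-APLP axioms (found by Gaussian
   elimination); two of the combinations below need 1/2. *)
Require Import Defs.
From mathcomp Require Import all_boot all_order all_algebra.
From mathcomp Require Import ring.

Set Implicit Arguments.
Unset Strict Implicit.
Unset Printing Implicit Defensive.

Import GRing.Theory.
Local Open Scope ring_scope.

(** * Pairing of functionals with vectors *)

Section Pairing.

Variable F : fieldType.
Implicit Types A U V W : vectType F.

(** Functionals take values in [F^o]; the pairing reads these as scalars of [F], where [ring] and
    [field] apply. *)
Definition pairing V (u : dual V) (v : V) : F := u v.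

Lemma pairingDr V (u : dual V) v w :
  pairing u (v + w) = pairing u v + pairing u w.
Proof. exact: (linearD u). Qed.

Lemma pairingNr V (u : dual V) v : pairing u (- v) = - pairing u v.
Proof. exact: (linearN u). Qed.

Lemma pairingZr V (u : dual V) c v : pairing u (c *: v) = c * pairing u v.
Proof. by rewrite /pairing linearZ. Qed.

Lemma pairing0r V (u : dual V) : pairing u 0 = 0.
Proof. exact: (linear0 u). Qed.

Lemma pairing_sumr V (u : dual V) I (s : seq I) (P : pred I) (v : I -> V) :
  pairing u (\sum_(i <- s | P i) v i) = \sum_(i <- s | P i) pairing u (v i).
Proof. exact: (linear_sum u). Qed.

Lemma pairingDl V (u w : dual V) v :
  pairing (u + w) v = pairing u v + pairing w v.
Proof. by rewrite /pairing add_lfunE. Qed.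

Lemma pairingNl V (u : dual V) v : pairing (- u) v = - pairing u v.
Proof. by rewrite /pairing opp_lfunE. Qed.

Lemma pairingZl V (u : dual V) c v : pairing (c *: u) v = c * pairing u v.
Proof. by rewrite /pairing scale_lfunE. Qed.

Lemma pairing0l V v : pairing (0 : dual V) v = 0.
Proof. by rewrite /pairing zero_lfunE. Qed.

Lemma pairing_suml V I (s : seq I) (P : pred I) (u : I -> dual V) v :
  pairing (\sum_(i <- s | P i) u i) v = \sum_(i <- s | P i) pairing (u i) v.
Proof. by rewrite /pairing sum_lfunE. Qed.

Definition pairingE := (pairingDr, pairingNr, pairingZr, pairing0r,
  pairingDl, pairingNl, pairingZl, pairing0l).

Lemma pairing_injr V (v w : V) :
  (forall u : dual V, pairing u v = pairing u w) -> v = w.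
Proof.
move=> vw; rewrite (coord_vbasis (memvf v)) (coord_vbasis (memvf w)).
apply: eq_bigr => i _; congr (_ *: _).
by have := vw (dual_basis (vbasis {:V}) i); rewrite /pairing !dual_basisE.
Qed.

Lemma pairing_injl V (u w : dual V) :
  (forall v, pairing u v = pairing w v) -> u = w.
Proof. by move=> uw; apply/lfunP. Qed.

Lemma bilinDl U V W (f : bilin U V W) x y z : f (x + y) z = f x z + f y z.
Proof. by rewrite linearD add_lfunE. Qed.

Lemma bilinNl U V W (f : bilin U V W) x z : f (- x) z = - f x z.
Proof. by rewrite linearN opp_lfunE. Qed.

Lemma bilinZl U V W (f : bilin U V W) c x z : f (c *: x) z = c *: f x z.
Proof. by rewrite linearZ scale_lfunE. Qed.

Lemma bilin_suml U V W (f : bilin U V W) n (x : 'I_n -> U) z :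
  f (\sum_i x i) z = \sum_i f (x i) z.
Proof. by rewrite linear_sum sum_lfunE. Qed.

Lemma bilinDr U V W (f : bilin U V W) z x y : f z (x + y) = f z x + f z y.
Proof. exact: linearD. Qed.

Lemma bilinNr U V W (f : bilin U V W) z x : f z (- x) = - f z x.
Proof. exact: linearN. Qed.

Lemma bilinZr U V W (f : bilin U V W) c z x : f z (c *: x) = c *: f z x.
Proof. exact: linearZ. Qed.

Definition bilinE := (bilinDl, bilinNl, bilinZl, bilinDr, bilinNr, bilinZr).

Lemma pairing_dual_rep A V (rho : bilin A V V) x (u : dual V) v :
  pairing (dual_rep rho x u) v = - pairing u (rho x v).
Proof. exact: dual_repE. Qed.

Lemma pairing_dual_basis_l V n (e : n.-tuple V) (f : dual V) v :
  basis_of fullv e ->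
  pairing (\sum_i pairing f (tnth e i) *: dual_basis e i) v = pairing f v.
Proof.
move=> be; rewrite pairing_suml [in RHS](coord_basis be (memvf v)).
rewrite pairing_sumr; apply: eq_bigr => i _.
by rewrite pairingZl pairingZr (tnth_nth 0) {2}/pairing dual_basisE mulrC.
Qed.

(** Reflexivity: the explicit sum is the vector at which the double-dual element [g] evaluates. *)
Lemma pairing_dual_basis_r V n (e : n.-tuple V) (g : dual (dual V)) u :
  basis_of fullv e ->
  pairing u (\sum_i pairing g (dual_basis e i) *: tnth e i) = pairing g u.
Proof.
move=> be.
have {2}-> : u = \sum_i pairing u (tnth e i) *: dual_basis e i.
  by apply: pairing_injl => v; rewrite pairing_dual_basis_l.
rewrite !pairing_sumr; apply: eq_bigr => i _.
by rewrite !pairingZr mulrC.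
Qed.

Lemma dual_precomp V W (f : dual V) (m : W -> V) :
  linear m -> exists k : dual W, forall w, pairing k w = pairing f (m w).
Proof.
move=> linm; exists (f \o linfun m)%VF => w.
by rewrite /pairing comp_lfunE linfunE.
Qed.

(* Cites the identity [x = y], contracted with [f] and scaled by [c], in the
   proof of a scalar identity. *)
Lemma lincomb V (c : F) (f : dual V) (x y : V) (a b : F) :
  x = y -> a = b + c * (pairing f x - pairing f y) -> a = b.
Proof. by move=> ->; rewrite subrr mulr0 addr0. Qed.

End Pairing.

Arguments lincomb {F V} c f {x y a b}.

(** * Sub-adjacent algebra and semi-direct product *)

Section SubAdjacent.

Variables (F : fieldType) (A : vectType F) (star succ prec : bilin A A A).
Hypothesis preA : pre_aplp star succ prec.

(** Apart from commutativity, each axiom is a signed sum of pre-APLP axioms whose distinguished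
    third argument runs through [x], [y] and [z]. *)
Lemma sub_adjacent_aplp : aplp (sub_dot star) (sub_circ succ prec).
Proof.
split.
- by move=> x y; rewrite !sub_dotE addrC.
- move=> x y z; apply: pairing_injr => f.
  apply: (lincomb (-1) f (pre_zinbiel preA z x y)).
  apply: (lincomb (-1) f (pre_zinbiel preA z y x)).
  apply: (lincomb 1 f (pre_zinbiel preA x y z)).
  apply: (lincomb 1 f (pre_zinbiel preA x z y)).
  by rewrite ?sub_dotE ?sub_circE !bilinE !pairingE; ring.
- split=> x y z; apply: pairing_injr => f.
  + apply: (lincomb 1 f (pre_apl2 preA y z x)).
    apply: (lincomb (-1) f (pre_apl1 preA x y z)).
    apply: (lincomb (-1) f (pre_apl2 preA x z y)).
    by rewrite /comm ?sub_dotE ?sub_circE !bilinE !pairingE; ring.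
  + apply: (lincomb 1 f (pre_apl3 preA z y x)).
    apply: (lincomb (-1) f (pre_apl3 preA x y z)).
    apply: (lincomb 1 f (pre_apl3 preA x z y)).
    by rewrite /comm ?sub_dotE ?sub_circE !bilinE !pairingE; ring.
- move=> x y z; apply: pairing_injr => f.
  apply: (lincomb 1 f (pre_compat1 preA x z y)).
  apply: (lincomb (-1) f (pre_compat2 preA y x z)).
  apply: (lincomb (-1) f (pre_compat1 preA y z x)).
  by rewrite ?sub_dotE ?sub_circE !bilinE !pairingE; ring.
- move=> x y z; apply: pairing_injr => f.
  apply: (lincomb 1 f (pre_compat3 preA z y x)).
  apply: (lincomb 1 f (pre_compat4 preA x z y)).
  apply: (lincomb 1 f (pre_compat5 preA x y z)).
  by rewrite ?sub_dotE ?sub_circE !bilinE !pairingE; ring.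
Qed.

Let mu := - dual_rep star.
Let l := dual_rep (flip prec) - dual_rep succ.
Let r := dual_rep (flip prec).

(** Moving the actions onto the vector turns identities in [dual A], tested on [t], into identities
    in [A]. *)
Lemma pairing_mu x u t : pairing (mu x u) t = pairing u (star x t).
Proof.
by rewrite opp_lfunE opp_lfunE pairingNl pairing_dual_rep opprK.
Qed.

Lemma pairing_r x u t : pairing (r x u) t = - pairing u (prec t x).
Proof. by rewrite pairing_dual_rep flipE. Qed.

Lemma pairing_l x u t :
  pairing (l x u) t = pairing u (succ x t) - pairing u (prec t x).
Proof.
rewrite add_lfunE opp_lfunE add_lfunE opp_lfunE pairingDl pairingNl.
by rewrite !pairing_dual_rep flipE opprK addrC.
Qed.

Definition semidirect_dot := semi_dot (sub_dot star) mu.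
Definition semidirect_circ := semi_circ (sub_circ succ prec) l r.

(** The [A]-component of each axiom is the sub-adjacent one. The other component, tested on [t],
    splits into an identity in [A] for each of the functionals [u], [v], [w]. *)
Lemma semidirect_aplp : (2 : F) != 0 -> aplp semidirect_dot semidirect_circ.
Proof.
move=> two_neq0.
have [dC dA [cA cC] k1 k2] := sub_adjacent_aplp.
have pairP (p q : A * dual A) :
    p.1 = q.1 -> (forall t, pairing p.2 t = pairing q.2 t) -> p = q.
  by case: p q => [x u] [y v] /= -> /pairing_injl ->.
have sumE (p q : A * dual A) : p + q = (p.1 + q.1, p.2 + q.2) by [].
have oppE (p : A * dual A) : - p = (- p.1, - p.2) by [].
have scaleE c (p : A * dual A) : c *: p = (c *: p.1, c *: p.2) by [].
have opE := (semi_dotE, semi_circE).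
have S := (sumE, oppE, scaleE).
have P := (pairing_mu, pairing_r, pairing_l).
rewrite /semidirect_dot /semidirect_circ.
split.
- move=> [x u] [y v]; rewrite !semi_dotE; congr pair; first exact: dC.
  by rewrite addrC.
- move=> [x u] [y v] [z w]; apply: pairP => [|t];
  rewrite !opE /=; first exact: dA.
  apply: (lincomb (-1) u (pre_zinbiel preA y z t)).
  apply: (lincomb (-1) v (pre_zinbiel preA x z t)).
  apply: (lincomb 1 v (pre_zinbiel preA z x t)).
  apply: (lincomb 1 w (pre_zinbiel preA y x t)).
  by rewrite !(P, pairingE) ?sub_dotE ?sub_circE ?bilinE !pairingE; ring.
- split=> [] [x u] [y v] [z w]; apply: pairP => [|t];
  rewrite /comm !(opE, S) /=.
  + exact: cA.
  + apply: (lincomb (-1) u (pre_apl2 preA y z t)).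
    apply: (lincomb 1 v (pre_apl2 preA x z t)).
    apply: (lincomb 2 w (pre_apl3 preA y x t)).
    apply: (lincomb 1 w (pre_apl1 preA x y t)).
    apply: (lincomb 1 w (pre_apl2 preA y x t)).
    apply: (lincomb (-1) w (pre_apl2 preA x y t)).
    by rewrite !(P, pairingE) ?sub_dotE ?sub_circE ?bilinE !pairingE; ring.
  + exact: cC.
  + apply: (lincomb (-1) u (pre_apl2 preA y z t)).
    apply: (lincomb (-1) u (pre_apl3 preA y z t)).
    apply: (lincomb 1 u (pre_apl2 preA z y t)).
    apply: (lincomb 1 v (pre_apl2 preA x z t)).
    apply: (lincomb 1 v (pre_apl3 preA x z t)).
    apply: (lincomb (-1) v (pre_apl2 preA z x t)).
    apply: (lincomb 1 w (pre_apl2 preA y x t)).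
    apply: (lincomb (-1) w (pre_apl2 preA x y t)).
    apply: (lincomb 1 w (pre_apl3 preA y x t)).
    by rewrite !(P, pairingE) ?sub_dotE ?sub_circE ?bilinE !pairingE; ring.
- move=> [x u] [y v] [z w]; apply: pairP => [|t];
  rewrite !(opE, S) /=; first exact: k1.
  apply: (lincomb (-1) u (pre_compat5 preA y z t)).
  apply: (lincomb 1 v (pre_compat5 preA x z t)).
  apply: (lincomb 1 w (pre_compat5 preA x y t)).
  apply: (lincomb (-1) w (pre_compat5 preA y x t)).
  (* Once [pre_compat5] has removed the [prec] terms, three times (x o y) * t - (y o x) * t = x > (y
     * t) - y > (x * t) is left. [pre_compat2] and [pre_compat4] give twice this identity, whence
     3/2. *)
  apply: (lincomb (- (3 / 2)) w (pre_compat4 preA x y t)).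
  apply: (lincomb (3 / 2) w (pre_compat2 preA x y t)).
  apply: (lincomb (3 / 2) w (pre_compat4 preA y x t)).
  by rewrite !(P, pairingE) ?sub_dotE ?sub_circE ?bilinE !pairingE; field.
- move=> [x u] [y v] [z w]; apply: pairP => [|t];
  rewrite !(opE, S) /=; first exact: k2.
  apply: (lincomb (-1) u (pre_compat3 preA z y t)).
  (* Modulo the instances cited with coefficients -1 and 1, the [v] part is three times z * (x > t)
     - z * (t < x) - x > (z * t) + t < (x . z), whose double vanishes by the three axioms cited with
     3/2. *)
  apply: (lincomb (3 / 2) v (pre_compat3 preA x z t)).
  apply: (lincomb (3 / 2) v (pre_compat1 preA x z t)).
  apply: (lincomb (- (3 / 2)) v (pre_compat5 preA x z t)).
  apply: (lincomb (-1) v (pre_compat3 preA z x t)).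
  apply: (lincomb 1 v (pre_compat4 preA x z t)).
  apply: (lincomb 1 w (pre_compat1 preA x y t)).
  by rewrite !(P, pairingE) ?sub_dotE ?sub_circE ?bilinE !pairingE; field.
Qed.

End SubAdjacent.

(** * The APLP-YBE for skew tensors *)

Section Tensor.

Variables (F : fieldType) (B : vectType F).
Implicit Types (f g h : dual B) (t : tens B B) (dot circ : bilin B B B).

Lemma tens_sum_evall t n (a b : 'I_n -> B) f :
  t = \sum_(i < n) pure B B (a i) (b i) ->
  t f = \sum_(i < n) pairing f (a i) *: b i.
Proof.
by move=> ->; rewrite sum_lfunE; apply: eq_bigr => i _; rewrite pureE.
Qed.

Lemma tens_skew_sum_evalr t n (a b : 'I_n -> B) g :
  tens_skew t -> t = \sum_(i < n) pure B B (a i) (b i) ->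
  \sum_(i < n) pairing g (b i) *: a i = - t g.
Proof.
move=> skew_t tE; rewrite -opp_lfunE -skew_t [in RHS]tE linear_sum sum_lfunE.
by apply: eq_bigr => i _; rewrite /= tens_swapE pureE.
Qed.

Lemma tens3_eq0 (s : tens B (tens B B)) :
  (forall f g h, pairing h ((s f : tens B B) g) = 0) -> s = 0.
Proof.
move=> s0; apply/lfunP => f; apply/lfunP => g; apply: pairing_injr => h.
by rewrite s0 !zero_lfunE pairing0r.
Qed.

Lemma pairing_pure3 (x y z : B) f g h :
  pairing h ((pure3 x y z f : tens B B) g)
    = pairing f x * pairing g y * pairing h z.
Proof. by rewrite pureE scale_lfunE pureE !pairingZr mulrA. Qed.

Lemma pairing_bilin_sum (m : bilin B B B) n (c d : 'I_n -> F)
    (a b : 'I_n -> B) f :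
  pairing f (m (\sum_i c i *: a i) (\sum_j d j *: b j))
    = \sum_i \sum_j c i * d j * pairing f (m (a i) (b j)).
Proof.
rewrite bilin_suml pairing_sumr; apply: eq_bigr => i _.
rewrite linear_sum pairing_sumr; apply: eq_bigr => j _ /=.
by rewrite bilinZl bilinZr !pairingZr mulrA.
Qed.

Lemma pairing_tens3_sum n (s : 'I_n -> 'I_n -> tens B (tens B B)) f g h :
  pairing h (((\sum_i \sum_j s i j) f : tens B B) g)
    = \sum_i \sum_j pairing h ((s i j f : tens B B) g).
Proof.
rewrite sum_lfunE sum_lfunE pairing_sumr; apply: eq_bigr => i _.
by rewrite sum_lfunE sum_lfunE pairing_sumr.
Qed.

(* A skew tensor [t] is determined by [t : dual B -> B], and contracting the
   three legs of the two equations with [f], [g], [h] expresses them through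
   the vectors [t f], [t g], [t h] only. *)
Lemma aplp_ybe_skew dot circ t :
  tens_skew t ->
  (forall f g h, pairing f (dot (t g) (t h)) + pairing g (dot (t h) (t f))
     + pairing h (dot (t f) (t g)) = 0) ->
  (forall f g h, pairing f (circ (t g) (t h)) - pairing g (circ (t f) (t h))
     - pairing h (comm circ (t f) (t g)) = 0) ->
  aplp_ybe dot circ t.
Proof.
move=> skew_t dot0 circ0 n a b tE.
have tl f := tens_sum_evall f tE.
have tr f : t f = - \sum_i pairing f (b i) *: a i.
  by rewrite (tens_skew_sum_evalr f skew_t tE) opprK.
(* The two letters name the legs left uncontracted in the two copies of [t]. Keeping a left leg
   costs a sign, so [ab] and [ba] carry a minus. *)
have aa (m : bilin B B B) f g h : pairing f (m (t g) (t h)) =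
    \sum_i \sum_j pairing g (b i) * pairing h (b j) * pairing f (m (a i) (a j)).
  by rewrite !tr bilinNl bilinNr opprK pairing_bilin_sum.
have ab (m : bilin B B B) f g h : - pairing f (m (t g) (t h)) =
    \sum_i \sum_j pairing g (b i) * pairing h (a j) * pairing f (m (a i) (b j)).
  by rewrite tr tl bilinNl pairingNr opprK pairing_bilin_sum.
have ba (m : bilin B B B) f g h : - pairing f (m (t g) (t h)) =
    \sum_i \sum_j pairing g (a i) * pairing h (b j) * pairing f (m (b i) (a j)).
  by rewrite tl tr bilinNr pairingNr opprK pairing_bilin_sum.
have bb (m : bilin B B B) f g h : pairing f (m (t g) (t h)) =
    \sum_i \sum_j pairing g (a i) * pairing h (a j) * pairing f (m (b i) (b j)).
  by rewrite !tl pairing_bilin_sum.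
(* Written as a bilinear map, the commutator can be expanded by [bb]. *)
have commE x y : comm circ x y = (circ - flip circ) x y.
  by rewrite add_lfunE opp_lfunE add_lfunE opp_lfunE flipE.
split; apply: tens3_eq0 => f g h; rewrite pairing_tens3_sum.
(* The double negation exposes the sign that [ab] expects; the indices then agree with the equation
   summand by summand. *)
- rewrite -[RHS](dot0 f g h) -[X in _ + X + _]opprK aa ab bb -sumrN -!big_split.
  apply: eq_bigr => i _; rewrite -sumrN -!big_split; apply: eq_bigr => j _ /=.
  rewrite !(add_lfunE, opp_lfunE, pairingDr, pairingNr) !pairing_pure3.
  by ring.
- rewrite -[RHS](circ0 f g h) commE aa ba bb -sumrN -!big_split.
  apply: eq_bigr => i _; rewrite -sumrN -!big_split; apply: eq_bigr => j _ /=.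
  rewrite !(add_lfunE, opp_lfunE, pairingDr, pairingNr) !pairing_pure3 commE.
  by rewrite !(add_lfunE, opp_lfunE, pairingDr, pairingNr); ring.
Qed.

End Tensor.

(** * The canonical tensor on A + A^* *)

Section CanonicalTensor.

Variables (F : fieldType) (A : vectType F) (n : nat) (e : n.-tuple A).
Hypothesis basis_e : basis_of fullv e.

Let B : vectType F := (A * dual A)%type.

Definition canonical_tens : tens B B :=
  \sum_(i < n) (pure B B (tnth e i, 0) (0, dual_basis e i)
                - pure B B (0, dual_basis e i) (tnth e i, 0)).

Lemma canonical_tens_skew : tens_skew canonical_tens.
Proof.
rewrite /tens_skew linear_sum -sumrN; apply: eq_bigr => i _ /=.
by rewrite linearB /= !tens_swapE opprB.
Qed.

(** Here [u] is the restriction of [f] to [A], and [a] represents its restriction to [dual A] by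
    reflexivity. *)
Lemma canonical_tensE (f : dual B) :
  exists a : A, exists u : dual A,
    (forall p : B, pairing f p = pairing u p.1 + pairing p.2 a)
    /\ canonical_tens f = (- a, u).
Proof.
have linL : linear (fun x : A => (x, 0) : B).
  by move=> c x y; congr pair; rewrite /= scaler0 addr0.
have linR : linear (fun v : dual A => (0, v) : B).
  by move=> c v w; congr pair; rewrite /= scaler0 addr0.
have [k kE] := dual_precomp f linL.
have [g gE] := dual_precomp f linR.
exists (\sum_i pairing g (dual_basis e i) *: tnth e i).
exists (\sum_i pairing k (tnth e i) *: dual_basis e i); split=> [[x v]|] /=.
  rewrite pairing_dual_basis_l // pairing_dual_basis_r // gE kE -pairingDr.
  by congr (pairing f (_, _)); rewrite ?addr0 ?add0r.
have sumE (s : 'I_n -> B) : \sum_i s i = (\sum_i (s i).1, \sum_i (s i).2).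
  by rewrite [LHS]surjective_pairing; congr pair; exact: big_morph.
rewrite sum_lfunE sumE -sumrN.
congr pair; apply: eq_bigr => i _; rewrite add_lfunE opp_lfunE !pureE /=.
- by rewrite scaler0 add0r gE.
- by rewrite scaler0 subr0 kE.
Qed.

End CanonicalTensor.

(* The first conjunct says that the semi-direct product is indeed an
   anti-pre-Lie Poisson algebra. *)
Theorem proposition3p47 (K : closedFieldType) (charK : [pchar K] =i pred0)
    (A : vectType K) (star succ prec : bilin A A A)
    (preA : pre_aplp star succ prec)
    (n : nat) (e : n.-tuple A) (basis_e : basis_of fullv e) :
  let dot := sub_dot star in
  let circ := sub_circ succ prec in
  let Lstar := star in
  let Lsucc := succ in
  let Rprec := flip prec in
  let B : vectType K := (A * dual A)%type in
  let dotB : bilin B B B := semi_dot dot (- dual_rep Lstar) in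
  let circB : bilin B B B :=
    semi_circ circ (dual_rep Rprec - dual_rep Lsucc) (dual_rep Rprec) in
  let inA (x : A) : B := (x, 0) in
  let inAd (u : dual A) : B := (0, u) in
  let r : tens B B := \sum_(i < n)
    (pure B B (inA (tnth e i)) (inAd (dual_basis e i))
     - pure B B (inAd (dual_basis e i)) (inA (tnth e i))) in
  [/\ aplp dotB circB, tens_skew r & aplp_ybe dotB circB r].
Proof.
move=> dot circ Lstar Lsucc Rprec B dotB circB inA inAd r.
have two_neq0 : (2 : K) != 0.
  by have := charK 2%N; rewrite inE /= => /negbT.
split; first exact: (semidirect_aplp preA two_neq0).
  exact: canonical_tens_skew.
apply: aplp_ybe_skew; first exact: canonical_tens_skew.
- move=> f g h.
  have [a [u [fE rf]]] := canonical_tensE basis_e f.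
  have [b [v [gE rg]]] := canonical_tensE basis_e g.
  have [c [w [hE rh]]] := canonical_tensE basis_e h.
  rewrite [r f]rf [r g]rg [r h]rh !semi_dotE fE gE hE /=.
  (* The term u (b . c) cancels against - u (c * b) and - u (b * c) from the other two summands, and
     likewise for [v] and [w]. *)
  rewrite !pairingE !pairing_mu !sub_dotE !(bilinE, pairingE).
  by ring.
- move=> f g h.
  have [a [u [fE rf]]] := canonical_tensE basis_e f.
  have [b [v [gE rg]]] := canonical_tensE basis_e g.
  have [c [w [hE rh]]] := canonical_tensE basis_e h.
  rewrite [r f]rf [r g]rg [r h]rh /comm pairingDr pairingNr.
  rewrite !semi_circE fE gE !hE /=.
  (* In the commutator the [prec] parts of the two actions cancel, leaving u (b > c) - v (a > c)
     beside w ([a, b]). *)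
  rewrite !pairingE !(pairing_l, pairing_r) !sub_circE !(bilinE, pairingE).
  by ring.
Qed.
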